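(* In the two-element $p$-nonconforming setting for the compressible Euler equations, adding the interface dissipation terms $$\boldsymbol{diss}_L=-\tfrac12(\mathsf P^L)^{-1}\mathsf R_L^T\mathsf P_{\perp}^L\Big|\tfrac{\partial\mathcal F_{\xi_1}}{\partial\mathcal W}\Big|_L\big(\mathsf R_L\boldsymbol w_L-\mathsf I_{H\to L}\mathsf R_H\boldsymbol w_H\big)-\tfrac12(\mathsf P^L)^{-1}\mathsf R_L^T\mathsf P_\perp^L\mathsf I_{H\to L}\Big|\tfrac{\partial\mathcal F_{\xi_1}}{\partial\mathcal W}\Big|_H\big(\mathsf I_{L\to H}\mathsf R_L\boldsymbol w_L-\mathsf R_H\boldsymbol w_H\big),$$ $$\boldsymbol{diss}_H=-\tfrac12(\mathsf P^H)^{-1}\mathsf R_H^T\mathsf P_{\perp}^H\Big|\tfrac{\partial\mathcal F_{\xi_1}}{\partial\mathcal W}\Big|_H\big(\mathsf R_H\boldsymbol w_H-\mathsf I_{L\to H}\mathsf R_L\boldsymbol w_L\big)-\tfrac12(\mathsf P^H)^{-1}\mathsf R_H^T\mathsf P_\perp^H\mathsf I_{L\to H}\Big|\tfrac{\partial\mathcal F_{\xi_1}}{\partial\mathcal W}\Big|_L\big(\mathsf I_{H\to L}\mathsf R_H\boldsymbol w_H-\mathsf R_L\boldsymbol w_L\big)$$ to the right-hand sides of the entropy conservative semi-discrete equations on elements $L$ and $H$, respectively, leads to an entropy stable scheme; that is, the added interface terms are entropy dissipative: $$\boldsymbol w_L^T\mathsf P^L\boldsymbol{diss}_L+\boldsymbol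 w_H^T\mathsf P^H\boldsymbol{diss}_H\le 0 .$$
   Context: Two hexahedral elements $L,H$ of degrees $p_L<p_H$, with computational coordinates $(\xi_1,\xi_2,\xi_3)$, share a face, which is the maximal-$\xi_1$ face of $L$ and the minimal-$\xi_1$ face of $H$. Element $\kappa\in\{L,H\}$ has $N_\kappa=p_\kappa+1$ Legendre–Gauss–Lobatto (LGL) nodes per direction; $\mathsf P_\kappa^{(1D)}$ is the diagonal, positive definite matrix of LGL weights. For the compressible Euler equations with 5 conserved variables $\mathcal Q$ and fluxes $\mathcal F_m$ ($m=1,2,3$), $\boldsymbol w_\kappa$ is the vector of nodal values of the entropy variables $\mathcal W^T=\partial\mathcal S/\partial\mathcal Q$, $\mathcal S=-\rho s$ ($\rho$ density, $s$ thermodynamic entropy); density and temperature are assumed positive. Operators: $\mathsf P^\kappa=\mathsf P_\kappa^{(1D)}\otimes\mathsf P_\kappa^{(1D)}\otimes\mathsf P_\kappa^{(1D)}\otimes\mathsf I_5$; $\mathsf P_\perp^\kappa=\mathsf P_\kappa^{(1D)}\otimes\mathsf P_\kappa^{(1D)}\otimes\mathsf I_5$; $\mathsf R_L=\boldsymbol e_{N_L}^T\otimes\mathsf I_{N_L}\otimes\mathsf I_{N_L}\otimes\mathsf I_5$, $\mathsf R_H=\boldsymbol e_{1_H}^T\otimes\mathsf I_{N_H}\otimes\mathsf I_{N_H}\otimes\mathsf I_5$, where $\boldsymbol e_{N_L}$ is the last and $\boldsymbol e_{1_H}$ the first unit vector; $\mathsf I_{H\to L}=\mathsf I_{H\to L}^{(1D)}\otimes\mathsf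 I_{H\to L}^{(1D)}\otimes\mathsf I_5$, $\mathsf I_{L\to H}=\mathsf I_{L\to H}^{(1D)}\otimes\mathsf I_{L\to H}^{(1D)}\otimes\mathsf I_5$, where the one-dimensional interpolation operators satisfy the SBP-preserving property $\mathsf I_{H\to L}^{(1D)}=(\mathsf P_L^{(1D)})^{-1}(\mathsf I_{L\to H}^{(1D)})^T\mathsf P_H^{(1D)}$. $|\partial\mathcal F_{\xi_1}/\partial\mathcal W|_\kappa$ is the block-diagonal matrix over the interface nodes of $\kappa$ with $5\times5$ symmetric positive semi-definite blocks $\mathsf Y|\mathsf\Lambda_{\xi_1}|\mathsf Y^T$, where $\mathcal F_{\xi_1}=\sum_m\mathcal J\frac{\partial\xi_1}{\partial x_m}\mathcal F_m$, $\partial\mathcal F_{\xi_1}/\partial\mathcal Q=\mathsf Y\mathsf\Lambda_{\xi_1}\mathsf Y^{-1}$ with $\mathsf\Lambda_{\xi_1}$ real diagonal and $\partial\mathcal Q/\partial\mathcal W=\mathsf Y\mathsf Y^T$; for $\kappa=L$ it is evaluated at the Roe average of the interface states $\boldsymbol w_L$ and $\mathsf I_{H\to L}\boldsymbol w_H$, for $\kappa=H$ at the Roe average of $\boldsymbol w_H$ and $\mathsf I_{L\to H}\boldsymbol w_L$. Entropy conservative / stable: the base semi-discrete scheme has the form $\mathsf J_\kappa\,\mathrm d\boldsymbol q_\kappa/\mathrm dt=\boldsymbol r_\kappa$ ($\mathsf J_\kappa$ the diagonal matrix of nodal metric Jacobians, $\boldsymbol q_\kappa$ the vector of nodal conserved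 variables on $\kappa$) and is entropy conservative: $\boldsymbol w_L^T\mathsf P^L\boldsymbol r_L+\boldsymbol w_H^T\mathsf P^H\boldsymbol r_H$ reduces to terms on the outer faces of the union of the two elements. The modified scheme $\mathsf J_\kappa\,\mathrm d\boldsymbol q_\kappa/\mathrm dt=\boldsymbol r_\kappa+\boldsymbol{diss}_\kappa$ is entropy stable if the rate of change of the total discrete entropy, $\sum_\kappa\boldsymbol w_\kappa^T\mathsf P^\kappa\mathsf J_\kappa\,\mathrm d\boldsymbol q_\kappa/\mathrm dt$, is bounded above by those same outer-face terms. *)

(* Defs.v *)
From HB Require Import structures.
From mathcomp Require Import all_boot all_order all_algebra.
From mathcomp Require Import all_classical all_reals all_analysis.
From mathcomp Require Export mxtens.

Set Implicit Arguments.
Unset Strict Implicit.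
Unset Printing Implicit Defensive.

Import Order.TTheory GRing.Theory Num.Theory.
Import numFieldNormedType.Exports.

Local Open Scope classical_set_scope.
Local Open Scope ring_scope.

(* The entropy of a calorically perfect gas is fixed up to the constant
   determined by the reference state. *)
Record ideal_gas (R : realType) := IdealGas {
  gas_const : R;
  gam : R;
  T_ref : R;
  rho_ref : R;
  gas_const_gt0 : 0 < gas_const;
  gam_gt1 : 1 < gam;
  T_ref_gt0 : 0 < T_ref;
  rho_ref_gt0 : 0 < rho_ref }.

Section Euler.
Context (R : realType) (G : ideal_gas R).

Definition heat_v : R := gas_const G / (gam G - 1).
Definition heat_p : R := gam G * heat_v.

Definition vec5 (a : R) (b : 'I_3 -> R) (c : R) : 'rV[R]_5 :=
  \row_k (if k == ord0 then a else if k == ord_max then c else b (inord k.-1)).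

(* Conserved variables Q = (rho, rho u_1, rho u_2, rho u_3, rho E), E being the
   specific total energy. *)
Definition density (q : 'rV[R]_5) : R := q 0 ord0.
Definition velocity (q : 'rV[R]_5) (m : 'I_3) : R :=
  q 0 (inord m.+1) / density q.
Definition total_energy (q : 'rV[R]_5) : R := q 0 ord_max / density q.
Definition kinetic (u : 'I_3 -> R) : R := (\sum_m u m ^+ 2) / 2.
Definition temperature (q : 'rV[R]_5) : R :=
  (total_energy q - kinetic (velocity q)) / heat_v.
Definition pressure (q : 'rV[R]_5) : R :=
  density q * gas_const G * temperature q.
Definition total_enthalpy (q : 'rV[R]_5) : R :=
  total_energy q + pressure q / density q.

Definition physical (q : 'rV[R]_5) : Prop := 0 < density q /\ 0 < temperature q.

Definition conserved (rho : R) (u : 'I_3 -> R) (T : R) : 'rV[R]_5 :=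
  vec5 rho (fun i => rho * u i) (rho * (heat_v * T + kinetic u)).

Definition euler_flux (m : 'I_3) (q : 'rV[R]_5) : 'rV[R]_5 :=
  let rho := density q in let u := velocity q in
  vec5 (rho * u m)
       (fun i => rho * u m * u i + (i == m)%:R * pressure q)
       (rho * u m * total_enthalpy q).

(* [a 0 m] is J d(xi_1)/d(x_m). *)
Definition contravariant_flux (a : 'rV[R]_3) (q : 'rV[R]_5) : 'rV[R]_5 :=
  \sum_m a 0 m *: euler_flux m q.

Definition thermo_entropy (q : 'rV[R]_5) : R :=
  heat_v * ln (temperature q / T_ref G)
  - gas_const G * ln (density q / rho_ref G).

Definition math_entropy (q : 'rV[R]_5) : R := - (density q * thermo_entropy q).

(* [jacobian] acts on row vectors, so entry (i, j) of its transpose is the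
   derivative of the i-th component along the j-th variable. *)
Definition dmx m n (f : 'rV[R]_m -> 'rV[R]_n) (q : 'rV[R]_m) : 'M[R]_(n, m) :=
  (jacobian f q)^T.

Definition entropy_vars (q : 'rV[R]_5) : 'rV[R]_5 :=
  dmx (fun q' => (math_entropy q')%:M : 'rV[R]_1) q.

(* The map W |-> Q; its value is unspecified when w is not the entropy variable
   of any state with positive density and temperature. *)
Definition state_of (w : 'rV[R]_5) : 'rV[R]_5 :=
  get [set q | physical q /\ entropy_vars q = w].

Definition roe_average (q1 q2 : 'rV[R]_5) : 'rV[R]_5 :=
  let s1 := Num.sqrt (density q1) in let s2 := Num.sqrt (density q2) in
  let avg x1 x2 := (s1 * x1 + s2 * x2) / (s1 + s2) in
  let u i := avg (velocity q1 i) (velocity q2 i) in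
  let H := avg (total_enthalpy q1) (total_enthalpy q2) in
  conserved (s1 * s2) u ((H - kinetic u) / heat_p).

Definition scaled_eigensystem (Y : 'rV[R]_3 -> 'rV[R]_5 -> 'M[R]_5)
    (Lam : 'rV[R]_3 -> 'rV[R]_5 -> 'rV[R]_5) : Prop :=
  forall (a : 'rV[R]_3) (q : 'rV[R]_5), physical q ->
    [/\ Y a q \in unitmx,
        dmx (contravariant_flux a) q
          = Y a q *m diag_mx (Lam a q) *m invmx (Y a q)
      & dmx state_of (entropy_vars q) = Y a q *m (Y a q)^T].

End Euler.

Section NodalVectors.
Context (R : realType).

(* Fields varying fastest: a nodal vector on n nodes has size n * 5. *)
Definition node_val n (v : 'cV[R]_(n * 5)) (i : 'I_n) : 'rV[R]_5 :=
  \row_k v (mxtens_index (i, k)) 0.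

Definition nodewise n (f : 'rV[R]_5 -> 'rV[R]_5) (v : 'cV[R]_(n * 5)) :
    'cV[R]_(n * 5) :=
  \col_j (let: (i, k) := mxtens_unindex j in f (node_val v i) 0 k).

Definition block_diag n (M : 'I_n -> 'M[R]_5) : 'M[R]_(n * 5) :=
  \sum_i delta_mx i i *t M i.

End NodalVectors.

Definition legendre (R : realType) (p : nat) : {poly R} :=
  ((2 ^ p * p`!)%:R)^-1 *: (('X^2 - 1) ^+ p)^`(p).

Definition is_LGL (R : realType) (p : nat) (x om : 'rV[R]_p.+1) : Prop :=
  [/\ forall i j : 'I_p.+1, (i < j)%N -> x 0 i < x 0 j,
      forall i, root ((1 - 'X^2) * (legendre R p)^`()) (x 0 i)
    & forall i, om 0 i = 2 / ((p * p.+1)%:R * (legendre R p).[x 0 i] ^+ 2)].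

Notation nvol p := (p.+1 * p.+1 * p.+1)%N.
Notation nface p := (p.+1 * p.+1)%N.

(* Row i of [face_metric] lists J d(xi_1)/d(x_m), m = 1, 2, 3, at the i-th
   interface node of the element. *)
Record element (R : realType) := Element {
  degree : nat;
  nodes1D : 'rV[R]_degree.+1;
  weights1D : 'rV[R]_degree.+1;
  metric_jac : 'rV[R]_(nvol degree);
  face_metric : 'M[R]_(nface degree, 3);
  degree_gt0 : (0 < degree)%N;
  LGL1D : is_LGL nodes1D weights1D;
  weights1D_gt0 : forall i, 0 < weights1D 0 i }.

Notation vol_vec R K := 'cV[R]_(nvol (degree K) * 5).
Notation face_vec R K := 'cV[R]_(nface (degree K) * 5).

Section Operators.
Context (R : realType).
Implicit Types K L H : element R.

Definition P1D K : 'M[R]_((degree K).+1) := diag_mx (weights1D K).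

(* In every tensor product the first factor is the xi_1 direction. *)
Definition Pvol K : 'M[R]_(nvol (degree K) * 5) :=
  P1D K *t P1D K *t P1D K *t (1%:M : 'M[R]_5).

Definition Pperp K : 'M[R]_(nface (degree K) * 5) :=
  P1D K *t P1D K *t (1%:M : 'M[R]_5).

Definition Jvol K : 'M[R]_(nvol (degree K) * 5) :=
  diag_mx (metric_jac K) *t (1%:M : 'M[R]_5).

(* The cast only removes the factor 1 from the row dimension. *)
Definition restrict_xi1 K (i : 'I_((degree K).+1)) :
    'M[R]_(nface (degree K) * 5, nvol (degree K) * 5) :=
  castmx (congr1 (fun k => k * (degree K).+1 * 5)%N (mul1n (degree K).+1), erefl)
    ((delta_mx 0 i : 'rV[R]_((degree K).+1)) *t (1%:M : 'M[R]_((degree K).+1))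
      *t (1%:M : 'M[R]_((degree K).+1)) *t (1%:M : 'M[R]_5)).

Definition RL L := @restrict_xi1 L ord_max.
Definition RH H := @restrict_xi1 H ord0.

Definition interp_face K K' (A : 'M[R]_((degree K').+1, (degree K).+1)) :
    'M[R]_(nface (degree K') * 5, nface (degree K) * 5) :=
  A *t A *t (1%:M : 'M[R]_5).

Definition SBP_preserving L H (IHL : 'M[R]_((degree L).+1, (degree H).+1))
    (ILH : 'M[R]_((degree H).+1, (degree L).+1)) : Prop :=
  IHL = invmx (P1D L) *m ILH^T *m P1D H.

(* |dF_{xi_1}/dW| at the interface nodes of K: [v] holds the interface entropy
   variables of K and [v'] those interpolated from the other element. *)
Definition abs_flux_jac (G : ideal_gas R)
    (Y : 'rV[R]_3 -> 'rV[R]_5 -> 'M[R]_5)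
    (Lam : 'rV[R]_3 -> 'rV[R]_5 -> 'rV[R]_5)
    K (v v' : face_vec R K) : 'M[R]_(nface (degree K) * 5) :=
  block_diag (fun i =>
    let a := row i (face_metric K) in
    let q := roe_average G (state_of G (node_val v i)) (state_of G (node_val v' i)) in
    Y a q *m diag_mx (map_mx Num.norm (Lam a q)) *m (Y a q)^T).

(* The term added on K, whose neighbour is K'; [M] and [M'] are the matrices
   |dF_{xi_1}/dW| of K and K', [I] interpolates from K' to K and [I'] from K
   to K'. *)
Definition interface_diss K K'
    (Rk : 'M[R]_(nface (degree K) * 5, nvol (degree K) * 5))
    (Rk' : 'M[R]_(nface (degree K') * 5, nvol (degree K') * 5))
    (I : 'M[R]_(nface (degree K) * 5, nface (degree K') * 5))
    (I' : 'M[R]_(nface (degree K') * 5, nface (degree K) * 5))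
    (M : 'M[R]_(nface (degree K) * 5)) (M' : 'M[R]_(nface (degree K') * 5))
    (w : vol_vec R K) (w' : vol_vec R K') : vol_vec R K :=
  - (2^-1 *: (invmx (Pvol K) *m Rk^T *m Pperp K *m M
                *m (Rk *m w - I *m Rk' *m w')))
  - 2^-1 *: (invmx (Pvol K) *m Rk^T *m Pperp K *m I *m M'
                *m (I' *m Rk *m w - Rk' *m w')).

Section TwoElements.
Context (G : ideal_gas R) (L H : element R).

Definition nodal_entropy_vars K (q : vol_vec R K) : vol_vec R K :=
  nodewise (entropy_vars G) q.

Definition physical_nodes K (q : vol_vec R K) : Prop :=
  forall i, physical G (node_val q i).

Section Dissipation.
Context (IHL : 'M[R]_((degree L).+1, (degree H).+1))
  (ILH : 'M[R]_((degree H).+1, (degree L).+1))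
  (Y : 'rV[R]_3 -> 'rV[R]_5 -> 'M[R]_5)
  (Lam : 'rV[R]_3 -> 'rV[R]_5 -> 'rV[R]_5)
  (qL : vol_vec R L) (qH : vol_vec R H).

Let I_HL := interp_face IHL.
Let I_LH := interp_face ILH.
Let wL := nodal_entropy_vars qL.
Let wH := nodal_entropy_vars qH.

Definition ML := abs_flux_jac G Y Lam (RL L *m wL) (I_HL *m RH H *m wH).
Definition MH := abs_flux_jac G Y Lam (RH H *m wH) (I_LH *m RL L *m wL).

Definition dissL : vol_vec R L :=
  interface_diss (RL L) (RH H) I_HL I_LH ML MH wL wH.
Definition dissH : vol_vec R H :=
  interface_diss (RH H) (RL L) I_LH I_HL MH ML wH wL.

End Dissipation.

(* w_L^T P^L r_L + w_H^T P^H r_H, the w's being the entropy variables of the q's. *)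
Definition entropy_pairing (qL : vol_vec R L) (qH : vol_vec R H)
    (rL : vol_vec R L) (rH : vol_vec R H) : R :=
  ((nodal_entropy_vars qL)^T *m Pvol L *m rL) 0 0
  + ((nodal_entropy_vars qH)^T *m Pvol H *m rH) 0 0.

(* Nodes of an element lying on one of its five faces other than the interface;
   [far] is the xi_1 index of the face opposite to the interface. *)
Definition outer_node K (far : 'I_((degree K).+1)) (n : 'I_(nvol (degree K))) :
    bool :=
  let: (ij, k) := mxtens_unindex n in let: (i, j) := mxtens_unindex ij in
  [|| i == far, j == ord0, j == ord_max, k == ord0 | k == ord_max].

(* Time is an argument because the data outside of the two elements may vary. *)
Definition outer_face_term (B : R -> vol_vec R L -> vol_vec R H -> R) : Prop :=
  forall t qL qL' qH qH',
    (forall n, outer_node ord0 n -> node_val qL n = node_val qL' n) ->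
    (forall n, outer_node ord_max n -> node_val qH n = node_val qH' n) ->
    B t qL qH = B t qL' qH'.

Definition entropy_conservative
    (rL : R -> vol_vec R L -> vol_vec R H -> vol_vec R L)
    (rH : R -> vol_vec R L -> vol_vec R H -> vol_vec R H)
    (B : R -> vol_vec R L -> vol_vec R H -> R) : Prop :=
  outer_face_term B /\
  forall t qL qH, physical_nodes qL -> physical_nodes qH ->
    entropy_pairing qL qH (rL t qL qH) (rH t qL qH) = B t qL qH.

(* The rate of change of the total discrete entropy, along any solution of the
   scheme, is at most B. *)
Definition entropy_stable
    (rL : R -> vol_vec R L -> vol_vec R H -> vol_vec R L)
    (rH : R -> vol_vec R L -> vol_vec R H -> vol_vec R H)
    (B : R -> vol_vec R L -> vol_vec R H -> R) : Prop :=
  forall (qL : R -> vol_vec R L) (qH : R -> vol_vec R H) (t : R),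
    physical_nodes (qL t) -> physical_nodes (qH t) ->
    derivable qL t 1 -> derivable qH t 1 ->
    Jvol L *m derive1 qL t = rL t (qL t) (qH t) ->
    Jvol H *m derive1 qH t = rH t (qL t) (qH t) ->
    entropy_pairing (qL t) (qH t) (Jvol L *m derive1 qL t) (Jvol H *m derive1 qH t)
      <= B t (qL t) (qH t).

End TwoElements.
End Operators.

(* Main.v *)
(** Put [a = R_L w_L], [b = R_H w_H]. The SBP-preserving property says that
    [I_HL] and [I_LH] are adjoint for the face quadratures, so that pairing the
    dissipation with the entropy variables gives
    [-1/2 ((a - I_HL b)^T Pperp_L M_L (a - I_HL b)
           + (I_LH a - b)^T Pperp_H M_H (I_LH a - b))].
    Both forms are nonnegative, since [M_L], [M_H] are block diagonal with
    blocks [Y |Lam| Y^T] and [Pperp] scales each block by a positive weight. *)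

Require Import Defs.
From mathcomp Require Import all_boot all_order all_algebra.
From mathcomp Require Import all_classical all_reals all_analysis.

Set Implicit Arguments.
Unset Strict Implicit.
Unset Printing Implicit Defensive.

Import Order.TTheory GRing.Theory Num.Theory.
Import numFieldNormedType.Exports.

Local Open Scope ring_scope.

Definition psd (R : realType) n (A : 'M[R]_n) : Prop :=
  forall x : 'cV[R]_n, 0 <= (x^T *m A *m x) 0 0.

Section PositiveSemidefinite.
Context (R : realType).

Lemma psd_sum (I : finType) n (A : I -> 'M[R]_n) :
  (forall i, psd (A i)) -> psd (\sum_i A i).
Proof.
move=> psdA x; rewrite mulmx_sumr mulmx_suml summxE.
by apply: sumr_ge0 => i _; apply: psdA.
Qed.

Lemma psd_scale n c (A : 'M[R]_n) : 0 <= c -> psd A -> psd (c *: A).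
Proof.
by move=> c_ge0 psdA x; rewrite -scalemxAr -scalemxAl mxE mulr_ge0 ?psdA.
Qed.

Lemma psd_congruence m n (E : 'M[R]_(m, n)) (A : 'M[R]_n) :
  psd A -> psd (E *m A *m E^T).
Proof.
by move=> psdA x; have := psdA (E^T *m x); rewrite trmx_mul trmxK !mulmxA.
Qed.

Lemma psd_castmx m n (e : m = n) (A : 'M[R]_m) : psd A -> psd (castmx (e, e) A).
Proof. by case: n / e. Qed.

Lemma psd_diag n (d : 'rV[R]_n) : (forall i, 0 <= d 0 i) -> psd (diag_mx d).
Proof.
move=> d_ge0 x; rewrite mul_mx_diag mxE; apply: sumr_ge0 => i _.
by rewrite !mxE mulrAC -expr2 mulr_ge0 ?sqr_ge0.
Qed.

(** The weight is constant over the five fields of a node, so it multiplies the block there as a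
    scalar and cannot spoil its sign. *)
Lemma psd_diag_block n (d : 'rV[R]_n) (M : 'I_n -> 'M[R]_5) :
  (forall i, 0 <= d 0 i) -> (forall i, psd (M i)) ->
  psd ((diag_mx d *t 1%:M) *m block_diag M).
Proof.
move=> d_ge0 psdM; rewrite /block_diag mulmx_sumr; apply: psd_sum => i.
(* [e] embeds the five fields of node [i] into the nodal vectors, which turns the summand into a
   congruence of one weighted block. *)
set e := (delta_mx i 0 : 'cV[R]_n) *t (1%:M : 'M[R]_5).
have -> : (diag_mx d *t 1%:M) *m (delta_mx i i *t M i)
    = e *m ((d 0 i)%:M *t M i) *m e^T.
  rewrite trmx_tens trmx1 !tensmx_mul mul1mx mulmx1; congr (_ *t _).
  rewrite mul_mx_scalar -scalemxAl trmx_delta mul_delta_mx mul_diag_mx.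
  apply/matrixP => j k; rewrite !mxE.
  by have [->|] := eqVneq j i; rewrite ?andbF ?mulr0.
(* Tensoring with a 1 by 1 scalar matrix is scaling, up to a cast from [1 * 5] to [5]. *)
apply: psd_congruence; rewrite tens_scalar_mx.
by apply: psd_castmx; apply: psd_scale.
Qed.

(** Used with [u] and [v] the two traces on one side of the interface: one term comes from the
    dissipation of each element, and together they form a square. *)
Lemma quadratic_form_subr m n (A : 'M[R]_n) (u v : 'M[R]_(n, m)) :
  u^T *m A *m (u - v) + v^T *m A *m (v - u) = (u - v)^T *m A *m (u - v).
Proof. by rewrite -(opprB u v) mulmxN -!mulmxBl -raddfB. Qed.

End PositiveSemidefinite.

Section Interface.
Context (R : realType).
Implicit Types K L H : element R.

(** Exhibits the face quadrature as a single diagonal of node weights, as [psd_diag_block] expects.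
    The type annotation relies on [1 * 1] computing to [1]. *)
Lemma diag_mx_tens m n (d : 'rV[R]_m) (e : 'rV[R]_n) :
  diag_mx d *t diag_mx e = diag_mx (d *t e : 'rV[R]_(m * n)).
Proof.
apply/matrixP => i j.
case: (mxtens_indexP i) => i1 i2; case: (mxtens_indexP j) => j1 j2.
rewrite tensmxE !mxE !mxtens_indexK !ord1 (can_eq (@mxtens_indexK _ _)) /=.
rewrite xpair_eqE; case: (i1 =P j1) => [->|_]; case: (i2 =P j2) => [->|_] //=.
all: by rewrite ?mulr1n ?mulr0n ?mulr0 ?mul0r.
Qed.

Lemma P1D_unit K : P1D K \in unitmx.
Proof.
rewrite unitmxE det_diag unitfE prodf_seq_neq0; apply/allP => i _.
by rewrite gt_eqF ?weights1D_gt0.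
Qed.

Lemma Pvol_unit K : Pvol K \in unitmx.
Proof.
have PPunit : P1D K *t P1D K \in unitmx by apply: tensmx_unit; rewrite ?P1D_unit.
rewrite /Pvol.
by apply: tensmx_unit; rewrite ?unitmx1 //; apply: tensmx_unit; rewrite ?P1D_unit.
Qed.

Lemma psd_Pperp_abs_flux_jac (G : ideal_gas R) Y Lam K (v v' : face_vec R K) :
  psd (Pperp K *m abs_flux_jac G Y Lam v v').
Proof.
rewrite /Pperp diag_mx_tens; apply: psd_diag_block => i.
  by rewrite mxE !ord1 mulr_ge0 ?ltW ?weights1D_gt0.
by apply/psd_congruence/psd_diag => k; rewrite mxE.
Qed.

Lemma Pperp_interp_adjoint K K' (A : 'M[R]_((degree K).+1, (degree K').+1)) A' :
  P1D K *m A = A'^T *m P1D K' ->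
  Pperp K *m interp_face A = (interp_face A')^T *m Pperp K'.
Proof.
by move=> PA; rewrite !trmx_tens !tensmx_mul PA trmx1.
Qed.

(** The inverse of [Pvol K] cancels against the quadrature of the pairing, and the transpose of [Rk]
    turns [w] into its trace [Rk *m w]. *)
Lemma interface_diss_pairing K K'
    (Rk : 'M[R]_(nface (degree K) * 5, nvol (degree K) * 5))
    (Rk' : 'M[R]_(nface (degree K') * 5, nvol (degree K') * 5))
    (I : 'M[R]_(nface (degree K) * 5, nface (degree K') * 5))
    (I' : 'M[R]_(nface (degree K') * 5, nface (degree K) * 5))
    (M : 'M[R]_(nface (degree K) * 5)) (M' : 'M[R]_(nface (degree K') * 5))
    (w : vol_vec R K) (w' : vol_vec R K') :
  Pperp K *m I = I'^T *m Pperp K' ->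
  w^T *m Pvol K *m interface_diss Rk Rk' I I' M M' w w' =
  - (2^-1 *: ((Rk *m w)^T *m (Pperp K *m M) *m (Rk *m w - I *m (Rk' *m w'))
     + (I' *m (Rk *m w))^T *m (Pperp K' *m M') *m (I' *m (Rk *m w) - Rk' *m w'))).
Proof.
move=> PI; rewrite /interface_diss mulmxBr mulmxN -!scalemxAr scalerDr opprD.
congr (- (_ *: _) - _ *: _).
  rewrite !mulmxA -(mulmxA w^T) mulmxV ?Pvol_unit // mulmx1.
  by rewrite trmx_mul.
(* In the cross term, adjointness moves the interpolation onto the trace of [w], so that [M'] is
   weighted by the quadrature of its own element. *)
rewrite !mulmxA -(mulmxA w^T) mulmxV ?Pvol_unit // mulmx1.
by rewrite -(mulmxA _ (Pperp K) I) PI !trmx_mul !mulmxA.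
Qed.

Lemma SBP_preserving_adjointL L H
    (IHL : 'M[R]_((degree L).+1, (degree H).+1)) ILH :
  SBP_preserving IHL ILH -> P1D L *m IHL = ILH^T *m P1D H.
Proof. by move=> ->; rewrite !mulmxA mulmxV ?P1D_unit // mul1mx. Qed.

(** Transpose of the previous relation, the weight matrices being symmetric. *)
Lemma SBP_preserving_adjointH L H
    (IHL : 'M[R]_((degree L).+1, (degree H).+1)) ILH :
  SBP_preserving IHL ILH -> P1D H *m ILH = IHL^T *m P1D L.
Proof.
move=> /SBP_preserving_adjointL /(congr1 trmx).
by rewrite !trmx_mul trmxK !tr_diag_mx.
Qed.

Lemma entropy_pairingD (G : ideal_gas R) L H (qL : vol_vec R L) (qH : vol_vec R H)
    rL rH dL dH :
  entropy_pairing G qL qH (rL + dL) (rH + dH) =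
  entropy_pairing G qL qH rL rH + entropy_pairing G qL qH dL dH.
Proof. by rewrite /entropy_pairing !mulmxDr !mxE addrACA. Qed.

Lemma diss_pairing_le0 (G : ideal_gas R) L H
    (IHL : 'M[R]_((degree L).+1, (degree H).+1)) ILH Y Lam
    (qL : vol_vec R L) (qH : vol_vec R H) :
  SBP_preserving IHL ILH ->
  entropy_pairing G qL qH (dissL G IHL ILH Y Lam qL qH)
    (dissH G IHL ILH Y Lam qL qH) <= 0.
Proof.
move=> sbp; rewrite /entropy_pairing /dissL /dissH.
rewrite !interface_diss_pairing; last 2 first.
- exact/Pperp_interp_adjoint/SBP_preserving_adjointH.
- exact/Pperp_interp_adjoint/SBP_preserving_adjointL.
set a := RL L *m _; set b := RH H *m _.
set IH := interp_face IHL; set IL := interp_face ILH.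
set A := Pperp L *m _; set C := Pperp H *m _.
have -> (x y : 'M[R]_1) :
    (- (2^-1 *: x)) 0 0 + (- (2^-1 *: y)) 0 0 = - (2^-1 * (x + y) 0 0).
  by rewrite !mxE -opprD -mulrDr.
(* Regroup by dissipation matrix instead of by element: the own term of one element joins the cross
   term of the other. *)
rewrite oppr_le0 mulr_ge0 ?invr_ge0 // [X in _ + X]addrC addrACA.
by rewrite !quadratic_form_subr mxE addr_ge0 // psd_Pperp_abs_flux_jac.
Qed.

End Interface.

Theorem theorem5 (R : realType) (G : ideal_gas R) (L H : element R)
  (IHL : 'M[R]_((degree L).+1, (degree H).+1))
  (ILH : 'M[R]_((degree H).+1, (degree L).+1))
  (Y : 'rV[R]_3 -> 'rV[R]_5 -> 'M[R]_5)
  (Lam : 'rV[R]_3 -> 'rV[R]_5 -> 'rV[R]_5)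
  (rL : R -> vol_vec R L -> vol_vec R H -> vol_vec R L)
  (rH : R -> vol_vec R L -> vol_vec R H -> vol_vec R H)
  (B : R -> vol_vec R L -> vol_vec R H -> R) :
  (degree L < degree H)%N ->
  SBP_preserving IHL ILH ->
  scaled_eigensystem G Y Lam ->
  entropy_conservative G rL rH B ->
  (forall (qL : vol_vec R L) (qH : vol_vec R H),
     physical_nodes G qL -> physical_nodes G qH ->
     entropy_pairing G qL qH (dissL G IHL ILH Y Lam qL qH)
       (dissH G IHL ILH Y Lam qL qH) <= 0)
  /\ entropy_stable G
       (fun t qL qH => rL t qL qH + dissL G IHL ILH Y Lam qL qH)
       (fun t qL qH => rH t qL qH + dissH G IHL ILH Y Lam qL qH) B.
Proof.
move=> _ sbp _ [_ conserv]; split=> [qL qH _ _|qL qH t pL pH _ _ -> ->].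
  exact: diss_pairing_le0.
(* The equations of motion have replaced the time derivatives; conservation evaluates the base part
   to [B], and the dissipation only lowers it. *)
by rewrite entropy_pairingD conserv // gerDl diss_pairing_le0.
Qed.
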